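(* Let $M$ be a smooth finite-dimensional manifold of dimension $n$ with charts $(U_i,\phi_i)$, $i\in I$. Let $\tilde TM$ denote the Frölicher tangent bundle of $M$ and $TM$ the classical tangent bundle. Define $\Phi:\tilde TM\to TM$ as follows: for $[c]\in\tilde TM$ let $x=c(0)$, choose $i\in I$ with $x\in U_i$, let $a=(\phi_i\circ c)'(0)$ and set $\Phi([c])=[x,i,a]$. Then $\Phi$ is well defined and a diffeomorphism of Frölicher spaces.
   Context: A Frölicher structure on a set $X$ is a pair $(C,F)$ with $C \subset \mathrm{Map}(\mathbb R,X)$ and $F\subset \mathrm{Map}(X,\mathbb R)$ such that $C=\{c:\mathbb R\to X \mid f\circ c\in C^\infty(\mathbb R,\mathbb R)\ \forall f\in F\}$ and $F=\{f:X\to\mathbb R\mid f\circ c\in C^\infty(\mathbb R,\mathbb R)\ \forall c\in C\}$. Elements of $C$ and $F$ are called (smooth) curves and (smooth) functions. A map $\phi:X\to Y$ of Frölicher spaces is smooth if $\phi\circ c$ is a curve of $Y$ for every curve $c$ of $X$; a diffeomorphism of Frölicher spaces is a smooth bijection with smooth inverse. Given maps $f_i:X\to X_i$ into Frölicher spaces, the initial structure on $X$ is the one whose curves are those $c$ with every $f_i\circ c$ a curve of $X_i$. A smooth finite-dimensional manifold $N$ (in particular $M$ and the classical $TM$) is a Frölicher space with structure $(C^\infty(\mathbb R,N),C^\infty(N,\mathbb R))$. Frölicher tangent bundle: for $x\in X$ let $C_x=\{c\in C: c(0)=x\}$; $c\sim d$ in $C_x$ iff $(f\circ c)'(0)=(f\circ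 d)'(0)$ for all $f\in F$; $T_xX=C_x/\!\sim$, with classes $[c]$; the Frölicher tangent bundle is the disjoint union of the $T_xX$, and carries the initial Frölicher structure with respect to the maps $[c]\mapsto ((f\circ c)(0),(f\circ c)'(0))\in\mathbb R^2$, $f\in F$. Classical tangent bundle: $TM$ is the set of equivalence classes $[x,i,a]$ with $i\in I$, $x\in U_i$, $a\in\mathbb R^n$, where $(x,i,a)$ and $(y,j,b)$ are equivalent iff $x=y$ and $d_{\phi_i(x)}(\phi_j\circ\phi_i^{-1})(a)=b$; its manifold structure is given by the charts $[x,i,a]\mapsto(\phi_i(x),a)$. *)

(* Defs.v *)
From HB Require Import structures.
From mathcomp Require Import all_boot all_order all_algebra.
From mathcomp Require Import all_classical all_reals all_analysis.

Set Implicit Arguments.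
Unset Strict Implicit.
Unset Printing Implicit Defensive.

Import Order.TTheory GRing.Theory Num.Theory.
Import numFieldNormedType.Exports.

Local Open Scope ring_scope.
Local Open Scope classical_set_scope.

Section Smoothness.
Context {R : realType} {V W : normedModType R}.

(* Used only for finite-dimensional V and for open U, where it is the usual
   notion: the values of f outside U are irrelevant. *)
Fixpoint Ck_on (k : nat) (U : set V) (f : V -> W) : Prop :=
  match k with
  | 0 => forall x, U x -> {for x, continuous f}
  | k'.+1 => (forall x, U x -> differentiable f x) /\
             (forall v : V, Ck_on k' U ('D_v f))
  end.

Definition smooth_on (U : set V) (f : V -> W) : Prop :=
  forall k, Ck_on k U f.

End Smoothness.

Section EquivalenceClasses.
Context {T : Type}.

Definition classes (r : T -> T -> Prop) : Type :=
  {C : set T | exists t, C = [set u | r t u]}.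

Definition class_of (r : T -> T -> Prop) (t : T) : classes r :=
  exist _ [set u | r t u] (ex_intro _ t erefl).

Definition class_repr (r : T -> T -> Prop) (C : classes r) : T :=
  sval (cid (svalP C)).

Lemma class_reprK (r : T -> T -> Prop) (C : classes r) :
  class_of r (class_repr C) = C.
Proof.
by case: C => C exC; apply: eq_exist => /=; rewrite /class_repr; case: cid.
Qed.

End EquivalenceClasses.

Section Froelicher.
Context {R : realType}.

(* The defining property of a Froelicher structure is the separate predicate
   is_froelicher.  For the pair (C^oo(R, N), C^oo(N, R)) of a manifold N it is a
   theorem (it contains Boman's theorem), and none of the notions below needs
   it to be meaningful. *)
Record froelicher (X : Type) := Froelicher {
  fcurve : set (R -> X) ;
  ffunction : set (X -> R) }.

Definition is_froelicher (X : Type) (S : froelicher X) : Prop :=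
  fcurve S = [set c : R -> X |
    forall f, ffunction S f -> smooth_on [set: R] (f \o c)] /\
  ffunction S = [set f : X -> R |
    forall c, fcurve S c -> smooth_on [set: R] (f \o c)].

Definition fsmooth (X Y : Type) (S : froelicher X) (S' : froelicher Y)
    (phi : X -> Y) : Prop :=
  forall c, fcurve S c -> fcurve S' (phi \o c).

Definition fdiffeomorphism (X Y : Type) (S : froelicher X) (S' : froelicher Y)
    (phi : X -> Y) : Prop :=
  fsmooth S S' phi /\
  exists psi : Y -> X, [/\ cancel phi psi, cancel psi phi & fsmooth S' S psi].

Definition initial_froelicher (X I : Type) (Y : I -> Type)
    (S : forall i, froelicher (Y i)) (g : forall i, X -> Y i) : froelicher X :=
  let C := [set c : R -> X | forall i, fcurve (S i) (g i \o c)] in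
  Froelicher C
    [set f : X -> R | forall c, C c -> smooth_on [set: R] (f \o c)].

Lemma initial_is_froelicher (X I : Type) (Y : I -> Type)
    (S : forall i, froelicher (Y i)) (g : forall i, X -> Y i) :
  (forall i, is_froelicher (S i)) -> is_froelicher (initial_froelicher S g).
Proof.
move=> HS; split=> //=; apply/seteqP; split=> c /=.
  by move=> Cc f Hf; exact: Hf.
move=> Hc i; have [EC EF] := HS i; rewrite EC => f Ff /=.
apply: (Hc (f \o g i)) => d /(_ i) Cd.
by move: Ff; rewrite EF => /(_ _ Cd).
Qed.

Definition normed_froelicher (V : normedModType R) : froelicher V :=
  Froelicher [set c : R -> V | smooth_on [set: R] c]
             [set f : V -> R | smooth_on [set: V] f].

End Froelicher.
Arguments froelicher : clear implicits.

Section FroelicherTangentBundle.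
Context {R : realType} {X : Type} (S : froelicher R X).

Record curve_at (x : X) := CurveAt {
  curve_at_fun :> R -> X ;
  curve_at_curve : fcurve S curve_at_fun ;
  curve_at_0 : curve_at_fun 0 = x }.

Definition curve_tangent (x : X) (c d : curve_at x) : Prop :=
  forall f, ffunction S f ->
    (f \o c)^`() 0 = (f \o d)^`() 0.

Definition ftangent_space (x : X) : Type := classes (@curve_tangent x).

Definition ftangent : Type := {x : X & ftangent_space x}.

Definition ftangent_class (x : X) (c : curve_at x) : ftangent :=
  existT _ x (class_of (@curve_tangent x) c).

(* [c] |-> ((f \o c)(0), (f \o c)'(0)), read off a representative *)
Definition ftangent_map (f : X -> R) (v : ftangent) : R * R :=
  let c := class_repr (projT2 v) in
  ((f \o c) 0, (f \o c)^`() 0).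

Lemma ftangent_mapE (f : X -> R) (x : X) (c : curve_at x) : ffunction S f ->
  ftangent_map f (ftangent_class c) = ((f \o c) 0, (f \o c)^`() 0).
Proof.
move=> Ff; rewrite /ftangent_map /=; set d := class_repr _.
have dc : curve_tangent d c.
  have : sval (class_of (@curve_tangent x) d) c by rewrite class_reprK.
  by [].
by rewrite !curve_at_0 (dc f Ff).
Qed.

Definition ftangent_froelicher : froelicher R ftangent :=
  initial_froelicher
    (fun _ : {f : X -> R | ffunction S f} => normed_froelicher (R * R)%type)
    (fun f => ftangent_map (sval f)).

End FroelicherTangentBundle.

Section Manifolds.
Context {R : realType} {E : normedModType R}.

(* A chart is a total map, only meaningful on its domain. *)
Record atlas (M : Type) := Atlas {
  chart_index : Type ;
  chart_dom : chart_index -> set M ;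
  chart : chart_index -> M -> E }.

(* f \o (chart A i)^-1, extended by 0 outside chart A i @` chart_dom A i *)
Definition in_chart (M : Type) (A : atlas M) (W : normedModType R)
    (i : chart_index A) (f : M -> W) (u : E) : W :=
  xget 0 [set f x | x in chart_dom i `&` [set x | chart i x = u]].

Lemma in_chartE (M : Type) (A : atlas M) (W : normedModType R)
    (i : chart_index A) (f : M -> W) (x : M) :
  {in chart_dom i &, injective (chart i)} -> chart_dom i x ->
  in_chart i f (chart i x) = f x :> W.
Proof.
move=> inj xi; rewrite /in_chart; case: xgetP => [w _ [y [yi /= yx] <-]|].
  by congr f; apply: inj; rewrite ?inE.
by move=> /(_ (f x)) /= []; exists x.
Qed.

(* The given atlas need not be maximal, and no countability axiom is imposed. *)
Record smooth_manifold (M : topologicalType) (A : atlas M) : Prop :=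
  SmoothManifold {
  manifold_hausdorff : hausdorff_space M ;
  chart_cover : forall x : M, exists i : chart_index A, chart_dom i x ;
  chart_dom_open : forall i : chart_index A, open (chart_dom i) ;
  chart_inj : forall i : chart_index A,
    {in chart_dom i &, injective (chart i)} ;
  chart_continuous : forall i : chart_index A,
    {within chart_dom i, continuous (chart i)} ;
  (* the image of chart i is open in E, and its inverse is continuous *)
  chart_open : forall (i : chart_index A) (O : set M),
    open O -> open (chart i @` (O `&` chart_dom i)) ;
  chart_transition : forall i j : chart_index A,
    smooth_on (chart i @` (chart_dom i `&` chart_dom j))
              (in_chart i (chart j)) }.

(* (C^oo(R, M), C^oo(M, R)): openness of the preimages of the chart domains,
   together with smoothness in charts, contains the continuity of c. *)
Definition manifold_froelicher (M : Type) (A : atlas M) : froelicher R M :=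
  Froelicher
    [set c : R -> M | forall i : chart_index A,
      open (c @^-1` chart_dom i) /\
      smooth_on (c @^-1` chart_dom i) (chart i \o c)]
    [set f : M -> R | forall i : chart_index A,
      smooth_on (chart i @` chart_dom i) (in_chart i f)].

End Manifolds.
Arguments atlas {R} E M.

Section ClassicalTangentBundle.
Context {R : realType} {E : normedModType R} {M : Type} (A : atlas E M).

Record tangent_triple := TangentTriple {
  triple_point : M ;
  triple_index : chart_index A ;
  triple_mem : chart_dom triple_index triple_point ;
  triple_vector : E }.

Definition triple_equiv (s t : tangent_triple) : Prop :=
  triple_point s = triple_point t /\
  'd (in_chart (triple_index s) (chart (triple_index t)))
     (chart (triple_index s) (triple_point s)) (triple_vector s)
  = triple_vector t.

Definition tangent : Type := classes triple_equiv.

(* [x, i, a] *)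
Definition tangent_class (x : M) (i : chart_index A) (xi : chart_dom i x)
    (a : E) : tangent :=
  class_of triple_equiv (TangentTriple xi a).

Definition tangent_dom (i : chart_index A) : set tangent :=
  [set v | exists x (xi : chart_dom i x) a, v = tangent_class xi a].

(* [x, i, a] |-> (chart i x, a); the pair is unique for v in tangent_dom i *)
Definition tangent_chart (i : chart_index A) (v : tangent) : E * E :=
  xget 0 [set p | exists x (xi : chart_dom i x) a,
    v = tangent_class xi a /\ p = (chart i x, a)].

Definition tangent_atlas : atlas (E * E)%type tangent :=
  Atlas tangent_dom tangent_chart.

End ClassicalTangentBundle.

(* Main.v *)
(* Every tangent vector at x is detected by globally smooth functions, because a
   bump function b supported in a compact subset of a chart image makes b and the
   b x_k, extended by 0, elements of F (Hausdorffness makes the support closed in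
   M).  Both the point and the chart derivative of a curve are smooth quotients of
   the data given by these functions, so Phi is well defined and smooth.  It is
   injective by the chain rule and surjective because t |-> p + e sin (t / e) a
   is a curve in the chart image defined on all of R.  Its inverse is smooth since
   [c] |-> (f (c 0), (f o c)' 0) reads (u, a) |-> (f u, d_u f a) in a chart. *)
From HB Require Import structures.
Require Import Defs.
From mathcomp Require Import all_boot all_order all_algebra.
From mathcomp Require Import all_classical all_reals all_analysis.
From mathcomp Require Import ring lra.
Set Implicit Arguments.
Unset Strict Implicit.
Unset Printing Implicit Defensive.

Import Order.TTheory GRing.Theory Num.Theory.
Import numFieldNormedType.Exports.
Local Open Scope ring_scope.
Local Open Scope classical_set_scope.

(** * Calculus of C^k maps *)

Section NearEq.
Context {R : numFieldType} {V W : normedModType R}.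

(** The first-order expansion of [f] at [x] is literally one of [g], the two having the same germ.
    Uniqueness of the differential then identifies ['d g x]. *)
Lemma near_eq_diff (f g : V -> W) (x : V) : {near x, f =1 g} ->
  differentiable f x -> differentiable g x /\ 'd g x = 'd f x :> (V -> W).
Proof.
move=> fg df.
have E : g \o shift x = cst (g x) + 'd f x +o_ 0 id.
  apply/eqaddoE/eqaddoP => _/posnumP[e].
  have e0 : 0 < e%:num by [].
  have /eqaddoP/(_ _ e0) Hf := diff_locally df.
  have fg0 : \forall y \near 0, f (y + x) = g (y + x).
    by move: fg; rewrite (near_shift 0 x)/= subr0.
  have fgx := nbhs_singleton fg.
  near=> y.
  rewrite (_ : (g \o shift x - _) y = (f \o shift x - (cst (f x) + 'd f x)) y).
    exact: (near Hf y).
  by rewrite !fctE /= /cst -fgx (near fg0 y).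
have D : 'd g x = 'd f x :> (V -> W).
  by apply: diff_unique => //; exact: diff_continuous.
split=> //; apply/diff_locallyP; rewrite D.
by split=> //; exact: diff_continuous.
Unshelve. all: by end_near. Qed.

End NearEq.

Lemma derive_comp (R : numFieldType) (V W Z : normedModType R)
    (f : V -> W) (g : W -> Z) (x v : V) :
  differentiable f x -> differentiable g (f x) ->
  'D_v (g \o f) x = 'D_('D_v f x) g (f x).
Proof.
move=> df dg; rewrite !deriveE//; last exact: differentiable_comp.
by rewrite (diff_comp df dg).
Qed.

Lemma derive_linear (R : numFieldType) (V W : normedModType R)
    (l : {linear V -> W}) (x v : V) : continuous l -> 'D_v l x = l v.
Proof.
by move=> cl; rewrite deriveE ?diff_lin//; exact: linear_differentiable.
Qed.

Section CkOn.
Context {R : realType}.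
Implicit Types V W Z : normedModType R.

(** Continuity and derivatives at a point depend only on the germ there, and openness of [U] turns
    equality on [U] into equality of germs. This is what allows total maps with junk values outside
    [U]. *)
Lemma eq_Ck_on V W k (U : set V) (f g : V -> W) : open U ->
  {in U, f =1 g} -> Ck_on k U f -> Ck_on k U g.
Proof.
move=> oU; elim: k f g => [|k IH] f g fg /=.
  move=> cf x Ux.
  have nfg : {near x, f =1 g}.
    near=> y; apply: fg; rewrite inE; near: y; exact: open_nbhs_nbhs.
  rewrite /prop_for /continuous_at -(nbhs_singleton nfg).
  apply: cvg_trans (cf x Ux); exact: near_eq_cvg.
move=> [df cdf].
have nfg x : U x -> {near x, f =1 g}.
  move=> Ux; near=> y; apply: fg; rewrite inE; near: y; exact: open_nbhs_nbhs.
split=> [x Ux|v]; first by have [] := near_eq_diff (nfg x Ux) (df x Ux).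
apply: IH (cdf v) => x; rewrite inE => Ux.
by apply: near_eq_derive; exact: nfg.
Unshelve. all: by end_near. Qed.

Lemma Ck_onS V W k (U U' : set V) (f : V -> W) :
  U' `<=` U -> Ck_on k U f -> Ck_on k U' f.
Proof.
move=> UU'; elim: k f => [|k IH] f /=; first by move=> cf x /UU'; exact: cf.
by move=> [df cdf]; split=> [x /UU'|v]; [exact: df|exact: IH].
Qed.

(** [Ck_on] is a conjunction of conditions at single points on the iterated directional derivatives
    of a total map, so it can be checked point by point. *)
Lemma Ck_on_local V W k (U : set V) (f : V -> W) :
  (forall x, U x -> exists2 U', U' x & Ck_on k U' f) -> Ck_on k U f.
Proof.
elim: k f => [|k IH] f /= H; first by move=> x /H[U' U'x]; exact.
split=> [x /H[U' U'x []]|v]; first by move=> + _; exact.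
by apply: IH => x /H[U' U'x []] _ /(_ v); exists U'.
Qed.

Lemma Ck_onW V W k (U : set V) (f : V -> W) : Ck_on k.+1 U f -> Ck_on k U f.
Proof.
elim: k f => [|k IH] f.
  by move=> [df _] x Ux; exact/differentiable_continuous/df.
by move=> [df cdf]; split=> // v; exact: IH.
Qed.

Lemma Ck_on_cst V W k (U : set V) (w : W) : Ck_on k U (cst w).
Proof.
elim: k w => [|k IH] w /=; first by move=> x _; exact: cvg_cst.
split=> [x _|v]; first exact: differentiable_cst.
have -> : 'D_v (cst w) = cst 0 :> (V -> W) by apply/funext => x; rewrite derive_cst.
exact: IH.
Qed.

Lemma Ck_onD V W k (U : set V) (f g : V -> W) : open U ->
  Ck_on k U f -> Ck_on k U g -> Ck_on k U (f + g).
Proof.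
move=> oU; elim: k f g => [|k IH] f g /=.
  by move=> cf cg x Ux; apply: cvgD; [exact: cf|exact: cg].
move=> [df cdf] [dg cdg]; split=> [x Ux|v].
  by apply: differentiableD; [exact: df|exact: dg].
apply: eq_Ck_on (IH _ _ (cdf v) (cdg v)) => // x; rewrite inE => Ux.
by rewrite deriveD//; apply: diff_derivable; [exact: df|exact: dg].
Qed.

Lemma Ck_on_sum V W k (U : set V) (I : Type) (r : seq I) (f : I -> V -> W) :
  open U -> (forall i, Ck_on k U (f i)) -> Ck_on k U (\sum_(i <- r) f i).
Proof.
move=> oU cf; elim/big_ind: _ => // [|g h cg ch]; first exact: Ck_on_cst.
exact: Ck_onD.
Qed.

Lemma Ck_on_linear V W Z k (U : set V) (f : V -> W) (l : {linear W -> Z}) :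
  open U -> continuous l -> Ck_on k U f -> Ck_on k U (l \o f).
Proof.
move=> oU cl; elim: k f => [|k IH] f /=.
  by move=> cf x Ux; apply: continuous_comp; [exact: cf|exact: cl].
have dl x : differentiable l x by exact: linear_differentiable.
move=> [df cdf]; split=> [x Ux|v].
  by apply: differentiable_comp; [exact: df|].
apply: eq_Ck_on (IH _ (cdf v)) => // x; rewrite inE => Ux /=.
by rewrite [RHS](derive_comp _ (df x Ux) (dl _)) derive_linear.
Qed.

(** Induction on the product rule ['D_v (a f) = 'D_v a *: f + a *: 'D_v f], obtained by viewing
    scaling as a continuous bilinear map composed with the pair of [a] and [f]. *)
Lemma Ck_on_scale V W k (U : set V) (a : V -> R) (f : V -> W) : open U ->
  Ck_on k U a -> Ck_on k U f -> Ck_on k U (fun x => a x *: f x).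
Proof.
move=> oU; elim: k a f => [|k IH] a f.
  by move=> ca cf x Ux; apply: cvgZ; [exact: ca|exact: cf].
move=> Ca Cf; have [da cda] := Ca; have [df cdf] := Cf.
have scb : bilinear_for (GRing.Scale.Law.clone _ _ *:%R _)
    (GRing.Scale.Law.clone _ _ *:%R _) (@GRing.scale R W).
  split=> [u b x y|u b x y] /=; first by rewrite scalerDl scalerA.
  by rewrite scalerDr !scalerA mulrC.
pose scM := bilinear_isBilinear.Build R R W W _ _ (@GRing.scale R W) scb.
pose scB : {bilinear R -> W -> W} := HB.pack (@GRing.scale R W) scM.
have scC : continuous (fun p : R * W => scB p.1 p.2) by exact: scale_continuous.
have dsc p := @differentiable_bilin _ _ _ _ scB p scC.
have dp x : U x -> differentiable (fun y => (a y, f y)) x.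
  by move=> Ux; apply: differentiable_pair; [exact: da|exact: df].
have E : (fun x => a x *: f x) =
   (fun p : R * W => scB p.1 p.2) \o (fun y => (a y, f y)) by [].
split=> [x Ux|v]; first by rewrite E; apply: differentiable_comp => //; exact: dp.
have C1 := Ck_onD oU (IH _ _ (cda v) (Ck_onW Cf))
  (IH _ _ (Ck_onW Ca) (cdf v)).
apply: eq_Ck_on C1 => // x; rewrite inE => Ux.
rewrite E [RHS](derive_comp _ (dp x Ux) (dsc _)).
transitivity ('d (fun p : R * W => scB p.1 p.2) (a x, f x)
    ('D_v (fun y => (a y, f y)) x)); last exact/esym/deriveE/dsc.
rewrite diff_bilin// (deriveE _ (dp _ Ux)) (diff_pair (da x Ux) (df x Ux)) /=.
by rewrite addrC -(deriveE v (df x Ux)) -(deriveE v (da x Ux)).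
Qed.

Lemma Ck_onM V k (U : set V) (a b : V -> R) : open U ->
  Ck_on k U a -> Ck_on k U b -> Ck_on k U (fun x => a x * b x).
Proof. by move=> oU ca cb; exact: Ck_on_scale. Qed.

Lemma Ck_onV V k (U : set V) (a : V -> R) : open U ->
  (forall x, U x -> a x != 0) -> Ck_on k U a -> Ck_on k U (fun x => (a x)^-1).
Proof.
move=> oU a0; elim: k => [|k IH].
  by move=> ca x Ux; apply: cvgV; [exact: a0|exact: ca].
move=> Ca; have [da cda] := Ca; split=> [x Ux|v].
  by apply: differentiableV; [exact: da|exact: a0].
have CV := IH (Ck_onW Ca).
(* The derivative of the inverse, written as the product of -1, [a^-1], [a^-1] and ['D_v a], all of
   class C^k by induction. *)
have C1 := Ck_onM oU (Ck_onM oU (Ck_onM oU (Ck_on_cst k U (-1 : R)) CV) CV) (cda v).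
apply: eq_Ck_on C1 => // x; rewrite inE => Ux.
rewrite deriveV; [|exact: a0|by apply: diff_derivable; exact: da].
by rewrite -exprVn -[RHS]/(_ * _) /cst expr2; ring.
Qed.

Lemma Ck_on_pair V W Z k (U : set V) (f : V -> W) (g : V -> Z) : open U ->
  Ck_on k U f -> Ck_on k U g -> Ck_on k U (fun x => (f x, g x)).
Proof.
move=> oU; elim: k f g => [|k IH] f g /=.
  by move=> cf cg x Ux; apply: cvg_pair; [exact: cf|exact: cg].
move=> [df cdf] [dg cdg].
have dp x : U x -> differentiable (fun y => (f y, g y)) x.
  by move=> Ux; apply: differentiable_pair; [exact: df|exact: dg].
split=> [//|v]; apply: eq_Ck_on (IH _ _ (cdf v) (cdg v)) => // x.
rewrite inE => Ux; rewrite [RHS]deriveE; last exact: dp.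
rewrite diff_pair; [|exact: df|exact: dg].
by rewrite !deriveE//; [exact: dg|exact: df].
Qed.

End CkOn.

(** * Composition of C^k maps, coordinates, sine and cosine *)

Section Chain.
Context {R : realType}.
Implicit Types V W Z : normedModType R.

(* A finite frame (e, l) of W turns the differential of g into a finite
   combination of its partial derivatives, to which the induction applies. *)
Lemma Ck_on_comp V W Z (I : finType) (e : I -> W) (l : I -> {linear W -> R})
    k (U : set V) (U' : set W) (f : V -> W) (g : W -> Z) :
  (forall i, continuous (l i)) -> (forall w, w = \sum_i l i w *: e i) ->
  open U -> U `<=` f @^-1` U' ->
  Ck_on k U f -> Ck_on k U' g -> Ck_on k U (g \o f).
Proof.
move=> cl le oU UU'; elim: k g => [|k IH] g.
  move=> cf cg x Ux; apply: continuous_comp; first exact: cf.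
  by apply: cg; exact: UU'.
move=> Cf [dg cdg]; have [df cdf] := Cf; split=> [x Ux|v].
  by apply: differentiable_comp; [exact: df|apply: dg; exact: UU'].
pose s i := fun x => l i ('D_v f x) *: 'D_(e i) g (f x).
apply: (@eq_Ck_on _ _ _ _ _ (\sum_i s i)) => // [x|].
  rewrite inE => Ux; rewrite fct_sumE.
  have dgx := dg _ (UU' _ Ux).
  rewrite [RHS](derive_comp _ (df _ Ux) dgx) (deriveE _ dgx).
  rewrite [in RHS](le ('D_v f x)) linear_sum; apply: eq_bigr => i _.
  by rewrite linearZ /s (deriveE _ dgx).
apply: Ck_on_sum => // i; apply: Ck_on_scale => //.
  by apply: (@Ck_on_linear _ _ _ _ _ _ ('D_v f) (l i)); [|exact: cl|exact: cdf].
by apply: (IH ('D_(e i) g)) => [|]; [exact: Ck_onW|exact: cdg].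
Qed.

(** Named so that a linear structure can be attached to it; these are the coordinate forms dual to
    the vectors [delta_mx 0 i]. *)
Definition rV_coord m (i : 'I_m) (u : 'rV[R]_m) : R := u 0 i.

Lemma rV_coord_is_linear m (i : 'I_m) : linear (rV_coord i).
Proof. by move=> a u v; rewrite /rV_coord !mxE. Qed.

HB.instance Definition _ m (i : 'I_m) :=
  GRing.isLinear.Build R 'rV[R]_m R _ (rV_coord i) (rV_coord_is_linear i).

Lemma rV_coord_continuous m (i : 'I_m) : continuous (rV_coord i).
Proof. exact: coord_continuous. Qed.

Lemma rV_coord_frame m (w : 'rV[R]_m) :
  w = \sum_i rV_coord i w *: delta_mx 0 i.
Proof. exact: row_sum_delta. Qed.

Lemma Ck_on_comp_rV V Z m k (U : set V) (U' : set 'rV[R]_m)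
    (f : V -> 'rV[R]_m) (g : 'rV[R]_m -> Z) :
  open U -> U `<=` f @^-1` U' ->
  Ck_on k U f -> Ck_on k U' g -> Ck_on k U (g \o f).
Proof.
apply: (@Ck_on_comp _ _ _ _ (fun i => delta_mx 0 i) (fun i => rV_coord i)).
  exact: rV_coord_continuous.
exact: rV_coord_frame.
Qed.

Lemma Ck_on_comp_R V Z k (U : set V) (U' : set R) (f : V -> R) (g : R -> Z) :
  open U -> U `<=` f @^-1` U' ->
  Ck_on k U f -> Ck_on k U' g -> Ck_on k U (g \o f).
Proof.
apply: (@Ck_on_comp V R Z 'I_1 (fun=> 1) (fun=> idfun)); first by move=> _ x.
by move=> w; rewrite big_ord1 /= [RHS]mulr1.
Qed.

Lemma Ck_on_rV V m k (U : set V) (f : V -> 'rV[R]_m) : open U ->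
  (forall i, Ck_on k U (fun x => f x 0 i)) -> Ck_on k U f.
Proof.
move=> oU cf.
have -> : f = \sum_i (fun x => f x 0 i *: delta_mx 0 i).
  by apply/funext => x; rewrite fct_sumE; exact: row_sum_delta.
by apply: Ck_on_sum => // i; apply: Ck_on_scale => //; exact: Ck_on_cst.
Qed.

Lemma Ck_on_coord V m k (U : set V) (f : V -> 'rV[R]_m) i : open U ->
  Ck_on k U f -> Ck_on k U (fun x => f x 0 i).
Proof.
move=> oU; apply: (@Ck_on_linear _ _ _ _ _ _ f (rV_coord i)) => //.
exact: rV_coord_continuous.
Qed.

Lemma Ck_on_id V k (U : set V) : Ck_on k U id.
Proof.
case: k => [|k]; first by move=> x _; exact: cvg_id.
split=> [x _|v]; first exact: ex_diff.
have -> : 'D_v id = cst v :> (V -> V) by apply/funext => x; rewrite derive_id.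
exact: Ck_on_cst.
Qed.

(** On the line ['D_v f] is [v *: f'], so the derivative in direction 1 controls all directions. *)
Lemma Ck_on_is_derive W k (U : set R) (f f' : R -> W) : open U ->
  (forall x, U x -> is_derive x (1 : R) f (f' x)) -> Ck_on k U f' -> Ck_on k.+1 U f.
Proof.
move=> oU ff' cf'; have df x : U x -> differentiable f x.
  by move=> /ff' [fx _]; exact/derivable1_diffP.
split=> // v; apply: (@eq_Ck_on _ _ _ _ _ (fun x => v *: f' x)) => // [x|].
  rewrite inE => Ux; rewrite (deriveE _ (df _ Ux)) diff1E; last exact: df.
  by rewrite derive1E; have [_ ->] := ff' _ Ux.
by apply: Ck_on_scale => //; exact: Ck_on_cst.
Qed.

(** Simultaneous induction, each function being the derivative of the other up to sign. *)
Lemma Ck_on_sin_cos k : Ck_on k setT (@sin R) /\ Ck_on k setT (@cos R).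
Proof.
elim: k => [|k [IHs IHc]].
  by split=> x _; [exact: continuous_sin|exact: continuous_cos].
split.
  by apply: (@Ck_on_is_derive _ _ _ _ cos) => //; exact: openT.
apply: (@Ck_on_is_derive _ _ _ _ (fun x => cst (-1) x *: sin x)).
- exact: openT.
- by move=> x _; apply: is_derive_eq; rewrite scaleN1r.
- apply: Ck_on_scale => //; [exact: openT|exact: Ck_on_cst].
Qed.

End Chain.

(** * Functions that are flat at the origin *)

Section Flat.
Context {R : realType}.

(* x^(-m) e^(-1/x): derivatives of these functions are combinations of them, so
   that smoothness only needs first derivatives of the whole family. *)
Definition flat (m : nat) (x : R) : R :=
  if 0 < x then x^-1 ^+ m * expR (- x^-1) else 0.

Lemma flat_gt0 m x : 0 < x -> 0 < flat m x.
Proof. by move=> x0; rewrite /flat x0 mulr_gt0 ?expR_gt0// exprn_gt0 ?invr_gt0. Qed.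

Lemma flat_eq0 m x : x <= 0 -> flat m x = 0.
Proof. by move=> x0; rewrite /flat ltNge x0. Qed.

(** For positive x, one term of the exponential series bounds [expR x^-1] below by
    [x^-1 ^+ m.+2 / m.+2!]. The quadratic bound is what makes the derivative at 0 vanish. *)
Lemma flat_le m x : `|flat m x| <= m.+2`!%:R * x ^+ 2.
Proof.
have [x0|x0] := leP x 0; first by rewrite flat_eq0// normr0 mulr_ge0 ?sqr_ge0.
have y0 : 0 < x^-1 by rewrite invr_gt0.
rewrite gtr0_norm ?flat_gt0// /flat x0 expRN.
rewrite ler_pdivrMr ?expR_gt0//.
have f0 : 0 < m.+2`!%:R :> R by rewrite ltr0n fact_gt0.
have H := expR_ge1Dxn m.+1 (ltW y0).
have H2 : x^-1 ^+ m.+2 / m.+2`!%:R <= expR x^-1 by apply: le_trans H; rewrite lerDr.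
apply: (@le_trans _ _ (m.+2`!%:R * x ^+ 2 * (x^-1 ^+ m.+2 / m.+2`!%:R))).
  rewrite le_eqVlt; apply/orP; left; apply/eqP.
  move: (m.+2`!%:R) f0 => F F0.
  have -> : x^-1 ^+ m.+2 = x^-1 ^+ m * x^-1 ^+ 2 by rewrite -exprD addn2.
  by move: (x^-1 ^+ m) => y; field; rewrite !gt_eqF.
by rewrite ler_pM2l// mulr_gt0// exprn_gt0.
Qed.

Lemma is_derive_flat m (x : R) :
  is_derive x (1 : R) (flat m) (flat m.+2 x - m%:R * flat m.+1 x).
Proof.
have [x0|x0|->] := ltgtP x 0.
- rewrite !flat_eq0 ?ltW// mulr0 subr0.
  apply: near_eq_is_derive (is_derive_cst 0 x 1).
  by near=> y; rewrite flat_eq0//; apply: ltW; near: y; exact: lt_nbhsl.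
- have xn0 : x != 0 by rewrite gt_eqF.
  apply: (@near_eq_is_derive R R R (fun y => y^-1 ^+ m * expR (- y^-1))).
    by near=> y; rewrite /flat ifT//; near: y; exact: lt_nbhsr.
  have dV : is_derive x 1 (fun y : R => y^-1) (- x ^- 2).
    apply: DeriveDef; first by apply: derivableV => //; exact: derivable_id.
    by rewrite deriveV//; rewrite derive_id scaleNr [_ *: _]mulr1.
  have dE : is_derive x 1 (fun y => expR (- y^-1)) (expR (- x^-1) * - - x ^- 2).
    have dN : is_derive x 1 (fun y : R => - y^-1) (- - x ^- 2) by exact: is_deriveN.
    exact: (@is_derive1_comp _ expR (fun y : R => - y^-1)).
  have dX : is_derive x 1 (fun y : R => y^-1 ^+ m) (m%:R * x^-1 ^+ m.-1 * - x ^- 2).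
    case: m => [|m].
      by rewrite /= !mul0r; exact: (is_derive_cst (1 : R) x (1 : R)).
    have -> : (fun y : R => y^-1 ^+ m.+1) = (fun y => y^-1) ^+ m.+1.
      by apply/funext => y; rewrite exprfctE.
    exact: is_deriveX.
  apply: is_derive_eq (is_deriveM dX dE) _.
  (* The power rule produces the exponent [m.-1], so the case m = 0 is separated. *)
  rewrite /flat x0 -![_ *: _]/(_ * _); case: m dX => [|m] _; last first.
    rewrite /=; have e2 j : x^-1 ^+ j.+1 = x^-1 ^+ j * x^-1 by rewrite exprSr.
    by rewrite !e2; move: (x^-1 ^+ m) (expR _) => y z; field.
  by move: (expR _) => z; field.
rewrite !flat_eq0// mulr0 subr0.
(* By [flat_le] the difference quotient at 0 is at most [m.+2!] times the absolute value of h. *)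
have H : (fun h : R => h^-1 *: ((flat m \o shift 0) (h *: 1) - flat m 0)) @ 0^' --> 0.
  apply/cvgrPdist_le => /= e e0; near=> h.
  have h0 : h != 0 by near: h; exact: nbhs_dnbhs_neq.
  rewrite sub0r normrN (flat_eq0 m (lexx 0)) subr0/= addr0 [h *: 1]mulr1.
  rewrite normrZ normfV ler_pdivrMl ?normr_gt0// (le_trans (flat_le _ _))//.
  rewrite -[h ^+ 2]ger0_norm ?sqr_ge0// normrX expr2 mulrA.
  rewrite mulrC ler_wpM2l// mulrC -ler_pdivlMr ?ltr0n ?fact_gt0//.
  near: h; apply: dnbhs0_le; rewrite divr_gt0// ltr0n fact_gt0.
by apply: DeriveDef; [apply/cvg_ex; exists 0|exact: cvg_lim].
Unshelve. all: by end_near. Qed.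

Lemma Ck_on_flat k m : Ck_on k setT (flat m).
Proof.
elim: k m => [|k IH] m.
  move=> x _; apply/differentiable_continuous/derivable1_diffP.
  by have [] := is_derive_flat m x.
apply: Ck_on_is_derive openT (fun x _ => is_derive_flat m x) _.
have -> : (fun x => flat m.+2 x - m%:R * flat m.+1 x) =
   flat m.+2 + (fun x => cst (- m%:R) x *: flat m.+1 x).
  by apply/funext => x; rewrite /= -mulNr.
apply: Ck_onD (openT) (IH _) _; apply: Ck_on_scale (openT) _ (IH _).
exact: Ck_on_cst.
Qed.

End Flat.

(** * Bump functions *)

Section Bump.
Context {R : realType}.

Lemma Ck_on_prod (V : normedModType R) k (U : set V) (I : Type) (r : seq I)
    (f : I -> V -> R) : open U -> (forall i, Ck_on k U (f i)) ->
  Ck_on k U (fun x => \prod_(i <- r) f i x).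
Proof.
move=> oU cf; elim: r => [|i r IH].
  by under eq_fun do rewrite big_nil; exact: Ck_on_cst.
by under eq_fun do rewrite big_cons; exact: Ck_onM.
Qed.

Lemma box_in_open m (O : set 'rV[R]_m) (p : 'rV[R]_m) : open O -> O p ->
  exists2 r : R, 0 < r &
    [set u : 'rV[R]_m | forall i, `[p 0 i - r, p 0 i + r] (u 0 i)] `<=` O.
Proof.
move=> oO Op; have /nbhs_ballP[e /= e0 eO] : nbhs p O by exact: open_nbhs_nbhs.
(* Balls of row vectors are those of the maximum norm; halving e puts the closed box inside the open
   ball. *)
exists (e / 2); first by rewrite divr_gt0.
move=> u /= Hu; apply: eO; split=> // i j.
rewrite !ord1 /ball /= ltr_norml; have := Hu j; rewrite in_itv/= => /andP[].
by have := e0; lra.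
Qed.

(** Each factor [flat 0 (r^2 - (u_i - p_i)^2)] is positive exactly when u_i is at distance less than
    r from p_i. The product therefore vanishes off a closed box, which is compact as a product of
    segments. *)
Lemma exists_bump m (O : set 'rV[R]_m) (p : 'rV[R]_m) : open O -> O p ->
  exists b : 'rV[R]_m -> R, [/\ smooth_on setT b, b p != 0 &
    exists K, [/\ compact K, K `<=` O & forall u, ~ K u -> b u = 0]].
Proof.
move=> oO Op; have [r r0 rO] := box_in_open oO Op.
exists (fun u => \prod_i flat 0 (r ^+ 2 - (u 0 i - p 0 i) ^+ 2)); split.
- move=> k; apply: Ck_on_prod openT _ => i.
  apply: (Ck_on_comp_R (g := flat 0) (f := fun u : 'rV[R]_m =>
    r ^+ 2 - (u 0 i - p 0 i) ^+ 2) openT _ _ (Ck_on_flat k 0)) => //.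
  have C1 : Ck_on k setT (fun u : 'rV[R]_m => u 0 i - p 0 i).
    apply: Ck_onD openT _ _; last exact: Ck_on_cst.
    exact: Ck_on_coord openT (Ck_on_id _ _).
  apply: Ck_onD openT _ _; first exact: Ck_on_cst.
  have -> : (fun u : 'rV[R]_m => - (u 0 i - p 0 i) ^+ 2) =
     (fun u => (cst (-1) u * (u 0 i - p 0 i)) * (u 0 i - p 0 i)).
    by apply/funext => u; rewrite /cst; ring.
  by apply: (Ck_onM openT _ C1); apply: (Ck_onM openT _ C1); exact: Ck_on_cst.
- apply/prodf_neq0 => i _.
  by rewrite gt_eqF// flat_gt0// subrr expr0n subr0 exprn_gt0.
exists [set u : 'rV[R]_m | forall i, `[p 0 i - r, p 0 i + r] (u 0 i)]; split=> //.
  apply: (@rV_compact _ _ (fun i => `[p 0 i - r, p 0 i + r])) => i.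
  exact: segment_compact.
move=> u /existsNP[i Hi]; apply/eqP/prodf_eq0; exists i => //; apply/eqP/flat_eq0.
rewrite subr_le0 leNgt; apply/negP => H; apply: Hi => /=.
have : `|u 0 i - p 0 i| < r.
  rewrite -(@ltr_pXn2r _ 2)// ?nnegrE ?(ltW r0)//.
  by rewrite real_normK// num_real.
by rewrite in_itv/= ltr_norml => /andP[]; lra.
Qed.

End Bump.

(** * Charts and tangent vectors *)

Section Charts.
Context {R : realType} {n : nat} {M : topologicalType} (A : atlas 'rV[R]_n M).
Hypothesis HM : smooth_manifold A.
Local Notation SM := (manifold_froelicher A).
Implicit Types (i j : chart_index A) (x y : M).

Lemma in_chart_chart (W : normedModType R) i (f : M -> W) x :
  chart_dom i x -> in_chart i f (chart i x) = f x.
Proof. by move=> xi; apply: in_chartE => //; exact: (chart_inj HM). Qed.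

Lemma open_chart_image i j : open (chart i @` (chart_dom i `&` chart_dom j)).
Proof. by rewrite setIC; apply: (chart_open HM); exact: (chart_dom_open HM). Qed.

Lemma open_chart_codom i : open (chart i @` chart_dom i).
Proof. by rewrite -[X in chart i @` X]setIid; exact: open_chart_image. Qed.

Lemma differentiable_transition i j x : chart_dom i x -> chart_dom j x ->
  differentiable (in_chart i (chart j)) (chart i x).
Proof.
by move=> xi xj; have [d _] := @chart_transition _ _ _ _ HM i j 1%N; apply: d; exists x.
Qed.

Lemma near_chart_change (W : normedModType R) i j (f : M -> W) x :
  chart_dom i x -> chart_dom j x ->
  {near chart i x, in_chart j f \o in_chart i (chart j) =1 in_chart i f}.
Proof.
move=> xi xj; have oU := @open_chart_image i j.
have : nbhs (chart i x) (chart i @` (chart_dom i `&` chart_dom j)).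
  by apply: open_nbhs_nbhs; split=> //; exists x.
apply: filterS => _ [y [yi yj] <-] /=.
by rewrite in_chart_chart// in_chart_chart// in_chart_chart.
Qed.

(** Chain rule for [f] read in chart i as [f] read in chart j after the transition, an identity that
    holds only near the point. With [f] a third chart it is the cocycle rule behind
    [triple_equiv]. *)
Lemma diff_chart_change (W : normedModType R) i j (f : M -> W) x a :
  chart_dom i x -> chart_dom j x ->
  differentiable (in_chart j f) (chart j x) ->
  'd (in_chart i f) (chart i x) a =
  'd (in_chart j f) (chart j x) ('d (in_chart i (chart j)) (chart i x) a).
Proof.
move=> xi xj df; have dT := differentiable_transition xi xj.
have df' : differentiable (in_chart j f) (in_chart i (chart j) (chart i x)).
  by rewrite in_chart_chart.
have dc := differentiable_comp dT df'.
have E := near_chart_change f xi xj.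
have [_ D] := near_eq_diff E dc.
apply: etrans (congr1 (@^~ a) D) _; apply: etrans (congr1 (@^~ a) (diff_comp dT df')) _.
by rewrite /= in_chart_chart.
Qed.

Lemma diff_transition_id i x a : chart_dom i x ->
  'd (in_chart i (chart i)) (chart i x) a = a.
Proof.
move=> xi; have E : {near chart i x, id =1 in_chart i (chart i)}.
  have : nbhs (chart i x) (chart i @` chart_dom i).
    by apply: open_nbhs_nbhs; split; [exact: open_chart_codom|exists x].
  by apply: filterS => _ [y yi <-] /=; rewrite in_chart_chart.
have did : is_diff (chart i x) id id := is_diff_id (chart i x).
have [_ D] := near_eq_diff E (let: DiffDef d _ := did in d).
by apply: etrans (congr1 (@^~ a) D) _; rewrite diff_val.
Qed.

Lemma near_curve_dom (c : R -> M) i t : fcurve SM c -> chart_dom i (c t) ->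
  \forall s \near t, chart_dom i (c s).
Proof. by move=> /(_ i)[oc _] cti; apply: open_nbhs_nbhs. Qed.

Lemma differentiable_chart_curve (c : R -> M) i t : fcurve SM c ->
  chart_dom i (c t) -> differentiable (chart i \o c) t.
Proof. by move=> /(_ i)[_ /(_ 1)[d _]]; exact: d. Qed.

(** A general target [W] covers both smooth functions and other charts; for a chart this is the
    transformation rule of velocities. *)
Lemma derive_in_chart (W : normedModType R) (f : M -> W) (c : R -> M) i t :
  fcurve SM c -> chart_dom i (c t) ->
  differentiable (in_chart i f) (chart i (c t)) ->
  (f \o c)^`() t = 'd (in_chart i f) (chart i (c t)) ((chart i \o c)^`() t).
Proof.
move=> cc cti df; have dc := differentiable_chart_curve cc cti.
have E : {near t, in_chart i f \o (chart i \o c) =1 f \o c}.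
  have := near_curve_dom cc cti; apply: filterS => s /= csi.
  by rewrite in_chart_chart.
have d1 := differentiable_comp dc df.
have [d2 D] := near_eq_diff E d1.
rewrite !derive1E (deriveE _ dc) [LHS](deriveE _ d2).
apply: etrans (congr1 (@^~ 1) D) _.
exact: (congr1 (@^~ 1) (diff_comp dc df)).
Qed.

Lemma differentiable_in_chart f i x : ffunction SM f -> chart_dom i x ->
  differentiable (in_chart i f) (chart i x).
Proof. by move=> /(_ i 1)[d _] xi; apply: d; exists x. Qed.

Lemma triple_equiv_refl (s : tangent_triple A) : triple_equiv s s.
Proof. by split=> //; exact/diff_transition_id/triple_mem. Qed.

Lemma triple_equiv_trans (s t u : tangent_triple A) :
  triple_equiv s t -> triple_equiv t u -> triple_equiv s u.
Proof.
case: s t u => [x i xi a] [y j yj b] [z k zk e] [/= xy <-] [/= yz <-].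
subst y; subst z; split=> //=.
by apply: diff_chart_change => //; exact: differentiable_transition.
Qed.

(** Going from i to j and back gives the differential of the transition from i to itself, which is
    the identity. *)
Lemma triple_equiv_sym (s t : tangent_triple A) :
  triple_equiv s t -> triple_equiv t s.
Proof.
case: s t => [x i xi a] [y j yj b] [/= xy <-]; subst y; split=> //=.
rewrite -diff_chart_change ?diff_transition_id//.
exact: differentiable_transition.
Qed.

(** Classes are subsets: reflexivity puts t in its own class, and symmetry with transitivity makes
    the classes of related elements coincide. *)
Lemma class_ofP (T : Type) (r : T -> T -> Prop) (s t : T) :
  (forall u, r u u) -> (forall u v, r u v -> r v u) ->
  (forall u v w, r u v -> r v w -> r u w) ->
  class_of r s = class_of r t <-> r s t.
Proof.
move=> rr rs rt; split=> [[E]|st].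
  by have : [set u | r t u] t by []; rewrite -E.
apply: eq_exist => /=; apply/seteqP; split=> u /= H; last exact: rt H.
by apply: rt H; exact: rs.
Qed.

Lemma tangent_classP x i (xi : chart_dom i x) a y j (yj : chart_dom j y) b :
  tangent_class xi a = tangent_class yj b <->
  x = y /\ 'd (in_chart i (chart j)) (chart i x) a = b.
Proof.
apply: class_ofP; [exact: triple_equiv_refl|exact: triple_equiv_sym|].
exact: triple_equiv_trans.
Qed.

Lemma tangent_class_inj x i (xi : chart_dom i x) a (xi' : chart_dom i x) b :
  tangent_class xi a = tangent_class xi' b -> a = b.
Proof. by move=> /tangent_classP[_]; rewrite diff_transition_id. Qed.

Lemma tangent_classE (v : tangent A) : exists x i (xi : chart_dom i x) a,
  v = tangent_class xi a.
Proof.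
rewrite -(class_reprK v); case: (class_repr v) => x i xi a.
by exists x, i, xi, a.
Qed.

(** The class determines the point, and within one chart also the vector, so [xget] has a single
    candidate. *)
Lemma tangent_chartE x i (xi : chart_dom i x) a :
  tangent_chart i (tangent_class xi a) = (chart i x, a).
Proof.
rewrite /tangent_chart; case: xgetP => [p _ [y [yi [b [E ->]]]]|].
  have /tangent_classP[xy _] := E; subst y.
  by rewrite (tangent_class_inj E).
by move=> /(_ (chart i x, a))[]; exists x, xi, a.
Qed.

Lemma curve_tangentP x (c d : curve_at SM x) :
  ftangent_class c = ftangent_class d <-> curve_tangent c d.
Proof.
rewrite -(@class_ofP _ (@curve_tangent _ _ SM x)); first last.
- by move=> u v w uv vw f Ff; rewrite uv// vw.
- by move=> u v uv f Ff; rewrite uv.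
- by [].
split=> [|E]; last by congr existT.
(* Dependent pairs over the same point are equal only if their fibre components are. *)
exact: eq_from_Tagged.
Qed.

Lemma ftangent_classE (v : ftangent SM) : exists x (c : curve_at SM x),
  v = ftangent_class c.
Proof.
case: v => x C; exists x, (class_repr C).
by rewrite /ftangent_class class_reprK.
Qed.

End Charts.

(** * Global functions and curves built in one chart *)

Section Local.
Context {R : realType} {n : nat} {M : topologicalType} (A : atlas 'rV[R]_n M).
Hypothesis HM : smooth_manifold A.
Local Notation SM := (manifold_froelicher A).
Implicit Types (i j : chart_index A) (x y : M).

(** The inverse of the chart as a total map, with value [x0] off the chart image. *)
Definition chart_inv (x0 : M) i (u : 'rV[R]_n) : M :=
  xget x0 [set y | chart_dom i y /\ chart i y = u].

Lemma chart_invK x0 i y : chart_dom i y -> chart_inv x0 i (chart i y) = y.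
Proof.
move=> yi; rewrite /chart_inv; case: xgetP => [z _ [zi zy]|/(_ y)[]//].
by apply: (chart_inj HM (i := i)); rewrite ?inE.
Qed.

Lemma chart_inv_continuous x0 i y : chart_dom i y ->
  {for chart i y, continuous (chart_inv x0 i)}.
Proof.
move=> yi P; rewrite /= chart_invK// nbhsE => -[B [oB By] BP].
have : nbhs (chart i y) (chart i @` (B `&` chart_dom i)).
  by apply: open_nbhs_nbhs; split; [exact: (chart_open HM)|exists y].
apply: filterS => _ [z [Bz zi] <-] /=; rewrite chart_invK//; exact: BP.
Qed.

(** The set is the image of [K] under the continuous inverse chart, hence compact, hence closed in a
    Hausdorff space. *)
Lemma chart_preimage_closed i (K : set 'rV[R]_n) : compact K ->
  K `<=` chart i @` chart_dom i -> closed (chart_dom i `&` chart i @^-1` K).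
Proof.
move=> cK KU.
(* A nonempty set supplies the default point of [chart_inv]. *)
have [->|/set0P[x0 _]] := eqVneq (chart_dom i `&` chart i @^-1` K) set0.
  exact: closed0.
suff -> : chart_dom i `&` chart i @^-1` K = chart_inv x0 i @` K.
  apply: (compact_closed (manifold_hausdorff HM)); apply: continuous_compact => //.
  apply: continuous_in_subspaceT => u; rewrite inE => /KU[y yi <-].
  exact: chart_inv_continuous.
apply/seteqP; split=> [y [yi Ky]|_ [u Ku <-]].
  by exists (chart i y) => //; rewrite chart_invK.
have [y yi yu] := KU _ Ku; subst u.
by rewrite chart_invK.
Qed.

(* Without the Hausdorff axiom the support of the extension need not be closed. *)
Lemma ffunction_extension i (g : 'rV[R]_n -> R) (K : set 'rV[R]_n) :
  smooth_on setT g -> compact K -> K `<=` chart i @` chart_dom i ->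
  (forall u, ~ K u -> g u = 0) ->
  ffunction SM (fun y => if `[<chart_dom i y>] then g (chart i y) else 0).
Proof.
move=> sg cK KU g0; set f := fun y => _.
move=> j k; apply: Ck_on_local => _ [y yj <-].
have [yi|nyi] := pselect (chart_dom i y).
  exists (chart j @` (chart_dom j `&` chart_dom i)); first by exists y.
  apply: (@eq_Ck_on _ _ _ _ _ (g \o in_chart j (chart i))).
  - exact: open_chart_image.
  - move=> u; rewrite inE => -[z [zj zi] <-] /=.
    by rewrite !(in_chart_chart HM)// /f; case: asboolP.
  - apply: (@Ck_on_comp_rV _ _ _ _ _ _ setT) => //.
      exact: open_chart_image.
    exact: (@chart_transition _ _ _ _ HM).
(* A point outside the domain of chart i lies in this open set, on which the extension vanishes. *)
pose O := ~` (chart_dom i `&` chart i @^-1` K).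
have oO : open O by rewrite openC; exact: chart_preimage_closed.
exists (chart j @` (O `&` chart_dom j)); first by exists y => //; split=> // -[].
apply: (@eq_Ck_on _ _ _ _ _ (cst 0)).
- exact: (chart_open HM).
- move=> u; rewrite inE => -[z [Oz zj] <-] /=.
  rewrite (in_chart_chart HM)// /f; case: asboolP => // zi.
  by rewrite g0// => Kz; apply: Oz.
- exact: Ck_on_cst.
Qed.

Lemma curve_derive_coord x (c : curve_at SM x) i k : chart_dom i x ->
  is_derive (0 : R) (1 : R) (fun t => chart i (c t) 0 k) ((chart i \o c)^`() 0 0 k).
Proof.
move=> xi; have dc : differentiable (chart i \o c) (0 : R).
  apply: differentiable_chart_curve; [exact: curve_at_curve|].
  by rewrite curve_at_0.
have dk : differentiable (rV_coord k : 'rV[R]_n -> R) ((chart i \o c) 0).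
  by apply: linear_differentiable; exact: rV_coord_continuous.
apply: DeriveDef; first by apply/diff_derivable/(differentiable_comp dc dk).
rewrite derive1E -[LHS]/('D_1 (rV_coord k \o (chart i \o c)) 0).
rewrite [LHS](derive_comp (1 : R) dc dk).
by apply: derive_linear; exact: rV_coord_continuous.
Qed.

(* With a bump f0 = b o chart i and f k = b x_k o chart i, the coordinates of a
   point and the chart derivative of a curve are quotients of values and
   derivatives of global functions. *)
Lemma local_coordinates i x : chart_dom i x ->
  exists (f0 : M -> R) (f : 'I_n -> M -> R),
  [/\ ffunction SM f0, (forall k, ffunction SM (f k)), f0 x != 0,
      (forall y, f0 y != 0 -> chart_dom i y) &
      forall y (c : curve_at SM y), f0 y != 0 -> forall k,
        chart i y 0 k = f k y / f0 y /\
        ((chart i \o c)^`() 0) 0 k =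
          ((f k \o c)^`()%classic 0 - f k y / f0 y * (f0 \o c)^`()%classic 0) / f0 y].
Proof.
move=> xi; have oU := @open_chart_codom _ _ _ _ HM i.
have [|b [sb bx [K [cK KU b0]]]] := @exists_bump R n _ (chart i x) oU.
  by exists x.
pose ext (g : 'rV[R]_n -> R) y := if `[<chart_dom i y>] then g (chart i y) else 0.
exists (ext b), (fun k => ext (fun u => b u * u 0 k)).
have Fb : ffunction SM (ext b) by exact: ffunction_extension sb cK KU b0.
have Fbk k : ffunction SM (ext (fun u => b u * u 0 k)).
  apply: (@ffunction_extension _ _ K) => //.
    move=> m; apply: (Ck_onM openT (sb m)).
    by apply: (Ck_on_coord k openT); exact: Ck_on_id.
  by move=> u /b0 ->; rewrite mul0r.
split=> //.
- by rewrite /ext; case: asboolP.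
- by move=> y; rewrite /ext; case: asboolP; rewrite ?eqxx.
move=> y c f0y k; have yi : chart_dom i y.
  by move: f0y; rewrite /ext; case: asboolP; rewrite ?eqxx.
have E : ext (fun u => b u * u 0 k) y = ext b y * chart i y 0 k.
  by rewrite /ext; case: asboolP.
split; first by rewrite E mulrAC mulfV// mul1r.
have dk := curve_derive_coord c k yi.
have cc : fcurve SM c by exact: curve_at_curve.
have c0 : chart_dom i (c 0) by rewrite curve_at_0.
have db : derivable (ext b \o c) 0 1.
  apply: diff_derivable.
  have dc := differentiable_chart_curve cc c0.
  have dex : differentiable (in_chart i (ext b)) ((chart i \o c) 0).
    exact: differentiable_in_chart.
  have Eb : {near 0, in_chart i (ext b) \o (chart i \o c) =1 ext b \o c}.
    have := near_curve_dom cc c0; apply: filterS => s /= csi.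
    by rewrite (in_chart_chart HM).
  by have [] := near_eq_diff Eb (differentiable_comp dc dex).
(* Leibniz rule for b times the k-th coordinate along c; solving it for the derivative of the
   coordinate gives the stated quotient. *)
have D : (ext (fun u => b u * u 0 k) \o c)^`() 0 =
    ext b y * ((chart i \o c)^`()%classic 0 0 k) +
    chart i y 0 k * (ext b \o c)^`()%classic 0.
  rewrite [LHS]derive1E.
  (* The factorization is used only near 0, where c stays in the chart domain. *)
  have En : {near (0 : R), (fun t => (ext b \o c) t * chart i (c t) 0 k) =1
               ext (fun u => b u * u 0 k) \o c}.
    have := near_curve_dom cc c0; apply: filterS => s /= csi.
    by rewrite /ext; case: asboolP.
  rewrite -(near_eq_derive _ En).
  have [dk1 dk2] := dk.
  rewrite (deriveM db dk1) dk2 /= curve_at_0.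
  by rewrite -(derive1E (ext b \o c)).
rewrite D E; move: ((chart i \o c)^`() 0 0 k) ((ext b \o c)^`() 0) (ext b y) f0y.
by move=> p q r r0; field.
Qed.

Lemma exists_curve_at x i (a : 'rV[R]_n) : chart_dom i x ->
  exists c : curve_at SM x, (chart i \o c)^`() 0 = a.
Proof.
move=> xi; have oU := @open_chart_codom _ _ _ _ HM i.
have [e e0 eU] : exists2 e : R, 0 < e & forall s : R, `|s| <= e ->
    (chart i @` chart_dom i) (chart i x + s *: a).
  have : (fun s : R => chart i x + s *: a) @ 0 --> chart i x.
    rewrite -[X in _ --> X]addr0 -(scale0r a).
    by apply: cvgD; [exact: cvg_cst|apply: cvgZr_tmp; exact: cvg_id].
  move=> /(_ (chart i @` chart_dom i))[].
    by apply: open_nbhs_nbhs; split=> //; exists x.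
  move=> e /= e0 He; exists (e / 2); first by rewrite divr_gt0.
  move=> s se; apply: He; rewrite /ball_/= sub0r normrN.
  by apply: le_lt_trans se _; rewrite ltr_pdivrMr// ltr_pMr// ltr1n.
(* The sine keeps the parameter within [-e, e], where the segment lies in the chart image for all
   times; the factor [e^-1] makes the velocity at 0 equal to [a]. *)
pose g (t : R) := chart i x + (e * sin (e^-1 * t)) *: a.
have gU t : (chart i @` chart_dom i) (g t).
  apply: eU; rewrite normrM (gtr0_norm e0) -[leRHS]mulr1 ler_wpM2l ?(ltW e0)//.
  by rewrite ler_norml sin_le1 sin_geN1.
have sg k : Ck_on k setT g.
  apply: (Ck_onD openT (Ck_on_cst _ _ _)).
  apply: (Ck_on_scale openT _ (Ck_on_cst _ _ _)).
  apply: (Ck_onM openT (Ck_on_cst _ _ _)).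
  apply: (Ck_on_comp_R (f := fun t => e^-1 * t) (g := @sin R) openT (U' := setT)) => //.
    by apply: (Ck_onM openT (Ck_on_cst _ _ _)); exact: Ck_on_id.
  by have [] := @Ck_on_sin_cos R k.
have gc : continuous g by move=> t; exact: (sg 0%N).
pose c := chart_inv x i \o g.
have cE t : chart_dom i (c t) /\ chart i (c t) = g t.
  by rewrite /c/=; have [y yi <-] := gU t; rewrite chart_invK.
have cc : fcurve SM c.
  move=> j.
  (* A curve must be tested in every chart j; since [c] stays in chart i, the transition from i to j
     reduces this to [g]. *)
  have E : c @^-1` chart_dom j =
      g @^-1` (chart i @` (chart_dom i `&` chart_dom j)).
    apply/seteqP; split=> t /=; have [cti ct] := cE t.
      by exists (c t).
    by move=> [y [yi yj] yg]; rewrite /c/= -yg chart_invK.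
  have oc : open (c @^-1` chart_dom j).
    by rewrite E; apply: open_comp => // ; exact: open_chart_image.
  split=> // k; apply: (@eq_Ck_on _ _ _ _ _ (in_chart i (chart j) \o g)) => //.
    move=> t _ /=; have [cti ct] := cE t.
    by rewrite -ct (in_chart_chart HM).
  apply: (Ck_on_comp_rV (U' := chart i @` (chart_dom i `&` chart_dom j))) => //.
  - by rewrite E.
  - by apply: Ck_onS (sg k).
  - exact: (@chart_transition _ _ _ _ HM).
have c0 : c 0 = x.
  by rewrite /c/= /g mulr0 sin0 mulr0 scale0r addr0 chart_invK.
exists (CurveAt cc c0).
have -> : chart i \o CurveAt cc c0 = g.
  by apply/funext => t /=; have [] := cE t.
have d1 : is_derive (0 : R) (1 : R) (fun t => e * sin (e^-1 * t)) 1.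
  have dl : is_derive (0 : R) (1 : R) (fun t => e^-1 * t) e^-1.
    by apply: is_derive_eq; rewrite [LHS]mulr1.
  have ds := is_derive1_comp (is_derive_sin (e^-1 * 0)) dl.
  have dz : is_derive (0 : R) (1 : R) (fun t => e * sin (e^-1 * t))
    (e *: (cos (e^-1 * 0) * e^-1)) := is_deriveZ e ds.
  apply: is_derive_eq dz _.
  by rewrite mulr0 cos0 mul1r [LHS]mulfV// gt_eqF.
have [/derivable1_diffP dd sE] := d1.
have dda := differentiableZl a dd.
rewrite derive1E /g deriveD; [|exact: derivable_cst|exact: diff_derivable].
rewrite derive_cst add0r (deriveE _ dda) (diffZl a dd).
by rewrite -(deriveE _ dd) sE scale1r.
Qed.

End Local.

(** * Comparison of the two tangent bundles *)

Section Comparison.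
Context {R : realType} {n : nat} {M : topologicalType} (A : atlas 'rV[R]_n M).
Hypothesis HM : smooth_manifold A.
Local Notation SM := (manifold_froelicher A).
Implicit Types (i j : chart_index A) (x y : M).

(** By [local_coordinates] the velocity in a chart is computed from derivatives of global functions
    along the curve, and tangent curves share these. *)
Lemma curve_tangent_chart x (c d : curve_at SM x) i : chart_dom i x ->
  curve_tangent c d -> (chart i \o c)^`() 0 = (chart i \o d)^`() 0.
Proof.
move=> xi cd; have [f0 [f [F0 F f0x _ H]]] := local_coordinates HM xi.
apply/rowP => k; have [_ ->] := H x c f0x k; have [_ ->] := H x d f0x k.
by rewrite (cd _ F0) (cd _ (F k)).
Qed.

Lemma derive_curve_at (W : normedModType R) (f : M -> W) x (c : curve_at SM x) i :
  chart_dom i x -> differentiable (in_chart i f) (chart i x) ->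
  (f \o c)^`() 0 = 'd (in_chart i f) (chart i x) ((chart i \o c)^`() 0).
Proof.
move=> xi df; have c0 := curve_at_0 c.
have := @derive_in_chart _ _ _ _ HM W f c i 0 (curve_at_curve c).
by rewrite c0; apply.
Qed.

(** Well-definedness of the comparison map: the curve is changed by [curve_tangent_chart], the chart
    by the chain rule applied to [chart j]. *)
Lemma tangent_class_curve x (c d : curve_at SM x) i j
    (xi : chart_dom i x) (xj : chart_dom j x) : curve_tangent c d ->
  tangent_class xi ((chart i \o c)^`() 0) = tangent_class xj ((chart j \o d)^`() 0).
Proof.
move=> cd; apply/(tangent_classP HM); split=> //.
rewrite (curve_tangent_chart xi cd) -derive_curve_at//.
exact: differentiable_transition.
Qed.

Lemma ftangent_mapE_chart f x (c : curve_at SM x) i : ffunction SM f ->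
  chart_dom i x -> ftangent_map f (ftangent_class c) =
  (f x, 'd (in_chart i f) (chart i x) ((chart i \o c)^`() 0)).
Proof.
move=> Ff xi; rewrite ftangent_mapE//= curve_at_0 -derive_curve_at//.
exact: differentiable_in_chart.
Qed.

(** The formula is required for every representative and every chart, so existence of such a map
    expresses independence of the choices. *)
Definition is_tangent_comparison (Phi : ftangent SM -> tangent A) : Prop :=
  forall x (c : curve_at SM x) i (xi : chart_dom i x),
    Phi (ftangent_class c) = tangent_class xi ((chart i \o c)^`() 0).

Lemma exists_tangent_comparison : exists Phi, is_tangent_comparison Phi.
Proof.
pose ix x := sval (cid (chart_cover HM x)).
have ixP x : chart_dom (ix x) x by rewrite /ix; case: cid.
exists (fun v : ftangent SM => tangent_class (ixP (projT1 v))
  ((chart (ix (projT1 v)) \o (class_repr (projT2 v) : curve_at SM (projT1 v)))^`() 0)).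
move=> x c i xi; apply: tangent_class_curve; apply/curve_tangentP.
by rewrite /ftangent_class class_reprK.
Qed.

(** * Bijectivity and smoothness of the comparison map *)

Section Phi.
Variable Phi : ftangent SM -> tangent A.
Hypothesis PhiE : is_tangent_comparison Phi.

(** Equal images have the same base point and, in one common chart, the same velocity; the chain
    rule then gives the same derivative along every smooth function. *)
Lemma tangent_comparison_inj : injective Phi.
Proof.
move=> v w; have [x [c ->]] := ftangent_classE v; have [y [d ->]] := ftangent_classE w.
have [i xi] := chart_cover HM x; rewrite (PhiE c xi) => E.
have [j yj] := chart_cover HM y; move: (E); rewrite (PhiE d yj).
move=> /(tangent_classP HM)[xy _]; subst y.
move: E; rewrite (PhiE d xi) => /(tangent_class_inj HM) E.
apply/curve_tangentP => f Ff.
have df := differentiable_in_chart Ff xi.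
by rewrite (derive_curve_at c xi df) E -(derive_curve_at d xi df).
Qed.

Lemma tangent_comparison_surj w : exists v, Phi v = w.
Proof.
have [x [i [xi [a ->]]]] := tangent_classE w.
have [c <-] := exists_curve_at HM a xi.
by exists (ftangent_class c).
Qed.

(** The maps generating the initial structure, expressed in classical coordinates; smoothness of the
    inverse rests on this. *)
Lemma ftangent_map_tangent f v x i (xi : chart_dom i x) a : ffunction SM f ->
  Phi v = tangent_class xi a ->
  ftangent_map f v = (f x, 'd (in_chart i f) (chart i x) a).
Proof.
move=> Ff; have [y [c ->]] := ftangent_classE v.
have [j yj] := chart_cover HM y; move=> E; move: (E); rewrite (PhiE c yj).
move=> /(tangent_classP HM)[xy _]; subst y.
move: E; rewrite (PhiE c xi) => /(tangent_class_inj HM) <-.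
exact: ftangent_mapE_chart.
Qed.

Lemma tangent_dom_comparison v i :
  tangent_dom i (Phi v) <-> chart_dom i (projT1 v).
Proof.
have [x [c ->]] := ftangent_classE v; split=> /=.
  have [j xj] := chart_cover HM x.
  by move=> [y [yi [a]]]; rewrite (PhiE c xj) => /(tangent_classP HM)[xy _]; rewrite xy.
by move=> xi; exists x, xi, ((chart i \o c)^`() 0); exact: PhiE.
Qed.

(** A curve of the initial structure is accessible only through the maps [ftangent_map h], so
    openness of chart preimages and smoothness in charts are both derived from such scalar data. *)
Lemma tangent_comparison_smooth :
  fsmooth (ftangent_froelicher SM) (manifold_froelicher (tangent_atlas A)) Phi.
Proof.
move=> g gc i; change (chart_index A) in i; set D := _ @^-1` _.
have local t : D t -> exists2 V : set R, [/\ open V, V t & V `<=` D] &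
    smooth_on V (tangent_chart i \o (Phi \o g)).
  move=> /tangent_dom_comparison xi.
  have [f0 [f [F0 F f0x f0i H]]] := local_coordinates HM xi.
  have sm h (Fh : ffunction SM h) k : Ck_on k setT (ftangent_map h \o g).
    exact: (gc (exist _ h Fh)).
  have sm1 h (Fh : ffunction SM h) k : Ck_on k setT (fun s => (ftangent_map h (g s)).1).
    apply: (@Ck_on_linear _ _ _ _ _ _ _ fst openT _ (sm h Fh k)).
    by move=> p; exact: cvg_fst.
  have sm2 h (Fh : ffunction SM h) k : Ck_on k setT (fun s => (ftangent_map h (g s)).2).
    apply: (@Ck_on_linear _ _ _ _ _ _ _ snd openT _ (sm h Fh k)).
    by move=> p; exact: cvg_snd.
  have m1 h v : (ftangent_map h v).1 = h (projT1 v).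
    by rewrite /ftangent_map /= curve_at_0.
  (* [V] is open because a scalar function is continuous, and nonvanishing of [f0] forces the base
     point into the chart domain. *)
  pose V : set R := (fun s => (ftangent_map f0 (g s)).1) @^-1` [set r | r != 0].
  have VE s : V s <-> f0 (projT1 (g s)) != 0 by rewrite -m1.
  exists V; first split.
  - apply: open_comp => [s _|]; last exact: open_neq.
    exact: (sm1 f0 F0 0%N s).
  - exact/VE.
  - by move=> s /VE/f0i si; apply/tangent_dom_comparison.
  move=> k.
  have oV : open V.
    apply: open_comp => [s _|]; last exact: open_neq.
    exact: (sm1 f0 F0 0%N s).
  have VT : V `<=` setT by [].
  (* [q1] and [q2] are the quotients of [local_coordinates]: the coordinates of the base point and
     of the velocity. *)
  pose q1 s l := (ftangent_map (f l) (g s)).1 / (ftangent_map f0 (g s)).1.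
  pose q2 s l := ((ftangent_map (f l) (g s)).2 - q1 s l * (ftangent_map f0 (g s)).2)
    / (ftangent_map f0 (g s)).1.
  have CV : Ck_on k V (fun s => ((ftangent_map f0 (g s)).1)^-1).
    by apply: Ck_onV => //; exact: Ck_onS VT (sm1 _ F0 k).
  have C1 l : Ck_on k V (q1 ^~ l).
    by apply: Ck_onM => //; exact: Ck_onS VT (sm1 _ (F l) k).
  have C2 l : Ck_on k V (q2 ^~ l).
    apply: Ck_onM => //; apply: Ck_onD => //; first exact: Ck_onS VT (sm2 _ (F l) k).
    have -> : (fun s => - (q1 s l * (ftangent_map f0 (g s)).2)) =
      (fun s => cst (-1) s * (q1 s l * (ftangent_map f0 (g s)).2)).
      by apply/funext => s; rewrite mulN1r.
    apply: Ck_onM => //; first exact: Ck_on_cst.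
    by apply: Ck_onM => //; exact: Ck_onS VT (sm2 _ F0 k).
  apply: (@eq_Ck_on _ _ _ _ _ (fun s => (\row_l q1 s l, \row_l q2 s l))) => //.
    move=> s; rewrite inE => Vs.
    have [y [c gE]] := ftangent_classE (g s).
    have f0y : f0 y != 0 by move/VE: Vs; rewrite gE.
    have yi := f0i _ f0y.
    rewrite [RHS]/= gE (PhiE c yi) (tangent_chartE HM).
    have m0 : ftangent_map f0 (g s) = (f0 y, (f0 \o c)^`() 0).
      by rewrite gE ftangent_mapE//= curve_at_0.
    have ml l : ftangent_map (f l) (g s) = (f l y, (f l \o c)^`() 0).
      by rewrite gE (ftangent_mapE _ (F l))/= curve_at_0.
    by congr pair; apply/rowP => l; have [E1 E2] := H y c f0y l;
      rewrite mxE ?E1 ?E2 /q2 /q1 m0 ml.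
  apply: Ck_on_pair => //; apply: Ck_on_rV => // l.
    by under eq_fun do rewrite mxE.
  by under eq_fun do rewrite mxE.
split.
  rewrite openE => t /local[V [oV Vt VD] _]; rewrite /interior.
  by apply: filterS VD _; apply: open_nbhs_nbhs.
by move=> k; apply: Ck_on_local => t /local[V [_ Vt _] /(_ k)]; exists V.
Qed.

Lemma tangent_comparison_inv_smooth psi : cancel psi Phi ->
  fsmooth (manifold_froelicher (tangent_atlas A)) (ftangent_froelicher SM) psi.
Proof.
move=> psiK g gc; rewrite /fcurve /= => -[f Ff] k /=; apply: Ck_on_local => t _.
have [x [i [xi [a gE]]]] := tangent_classE (g t).
have [oV sV] := gc i; rewrite /= in oV sV; set V := g @^-1` _ in oV sV.
exists V; first by rewrite /V /= gE; exists x, xi, a.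
pose q s := tangent_chart i (g s).
have C1 m : Ck_on m V (fun s => (q s).1).
  apply: (@Ck_on_linear _ _ _ _ _ _ q fst oV _ (sV m)).
  by move=> p; exact: cvg_fst.
have C2 m : Ck_on m V (fun s => (q s).2).
  apply: (@Ck_on_linear _ _ _ _ _ _ q snd oV _ (sV m)).
  by move=> p; exact: cvg_snd.
have VU : V `<=` (fun s => (q s).1) @^-1` (chart i @` chart_dom i).
  move=> s [y [yi [b sE]]]; rewrite /q /= sE (tangent_chartE HM).
  by exists y.
(* The differential of [f] in the chart is expanded in partial derivatives, so that base point and
   vector enter through C^k maps separately. *)
apply: (@eq_Ck_on _ _ _ _ _ (fun s => (in_chart i f (q s).1,
  \sum_l (q s).2 0 l *: 'D_(delta_mx 0 l) (in_chart i f) (q s).1))) => //.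
  move=> s; rewrite inE => -[y [yi [b sE]]].
  have -> : (ftangent_map f \o (psi \o g)) s =
     (f y, 'd (in_chart i f) (chart i y) b).
    by apply: (ftangent_map_tangent (xi := yi)) => //; rewrite psiK.
  rewrite /q /= sE (tangent_chartE HM) /= (in_chart_chart HM)//; congr pair.
  have df := differentiable_in_chart Ff yi.
  rewrite [in RHS](row_sum_delta b) linear_sum; apply: eq_bigr => l _.
  by rewrite linearZ (deriveE _ df).
apply: Ck_on_pair => //.
  exact: (Ck_on_comp_rV (g := in_chart i f) oV VU (C1 k) (Ff i k)).
have -> : (fun s => \sum_l (q s).2 0 l *: 'D_(delta_mx 0 l) (in_chart i f) (q s).1) =
  \sum_l (fun s => (q s).2 0 l *: 'D_(delta_mx 0 l) (in_chart i f) (q s).1).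
  by apply/funext => s; rewrite fct_sumE.
apply: Ck_on_sum => // l; apply: Ck_on_scale => //.
  exact: Ck_on_coord.
apply: (Ck_on_comp_rV (g := 'D_(delta_mx 0 l) (in_chart i f)) oV VU (C1 k)).
(* A partial derivative costs one order, hence [k.+1]. *)
by have [_] := Ff i k.+1; exact.
Qed.

End Phi.

End Comparison.

Theorem theorem6 (R : realType) (n : nat) (M : topologicalType)
    (A : atlas 'rV[R]_n M) (HM : smooth_manifold A) :
  let SM := manifold_froelicher A in
  let is_Phi (Phi : ftangent SM -> tangent A) :=
    forall (x : M) (c : curve_at SM x) (i : chart_index A)
      (xi : chart_dom i x),
    Phi (ftangent_class c) = tangent_class xi ((chart i \o c)^`() 0) in
  (exists! Phi, is_Phi Phi) /\
  (forall Phi, is_Phi Phi ->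
    fdiffeomorphism (ftangent_froelicher SM)
      (manifold_froelicher (tangent_atlas A)) Phi).
Proof.
move=> SM is_Phi; split.
  have [Phi PhiE] := exists_tangent_comparison HM.
  exists Phi; split=> // Psi PsiE; apply/funext => v.
  have [x [c ->]] := ftangent_classE v; have [i xi] := chart_cover HM x.
  by rewrite (PhiE x c i xi) (PsiE x c i xi).
move=> Phi PhiE; split; first exact: (tangent_comparison_smooth HM PhiE).
(* A right inverse chosen by surjectivity; injectivity makes it two-sided. *)
have /choice[psi psiK] := tangent_comparison_surj HM PhiE.
exists psi; split=> //; last exact: (tangent_comparison_inv_smooth HM PhiE psiK).
by move=> v; apply: (tangent_comparison_inj HM PhiE).
Qed.
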